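(* Let $\Delta$ be a finite non-empty simplicial complex on the vertex set $[n]$, let $i\in[n]$, and let $\mathfrak{I}\subseteq\mathbb{R}_\Delta$ be a cone of cooperative games that contains the carrier games $v_T$ (for non-empty $T\in\operatorname{St}_\Delta i$) and $\hat v_T$ (for all $T\in \operatorname{St}_\Delta i$). Let $\phi_i:\mathfrak{I}\to\mathbb{R}$ be an individual value that can be written as $$\phi_i(v)=\sum_{T\in \operatorname{Lk}_\Delta i}p_T\left(v(T\cup i)-v(T)\right)\qquad(v\in\mathfrak I)$$ with real numbers $p_T$ satisfying $\sum_{T\in \operatorname{Lk}_\Delta i} p_T=1$, and assume that $\phi_i$ satisfies the monotonicity axiom. Then the constants $\{p_T\}_{T\in\operatorname{Lk}_\Delta i}$ form a probability distribution on $\operatorname{Lk}_\Delta i$.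
   Context: $[n]=\{1,\dots,n\}$. A simplicial complex $\Delta$ on $[n]$ is a family of subsets of $[n]$ closed under taking subsets; $[n]$ is its set of vertices (players). We write $T\cup i$ for $T\cup\{i\}$. A cooperative game on $\Delta$ is a function $v:\Delta\to\mathbb{R}$ with $v(\emptyset)=0$; $\mathbb{R}_\Delta$ is the real vector space of all such functions. A cone $\mathfrak{I}\subseteq\mathbb{R}_\Delta$ is a subset closed under multiplication by positive scalars. An individual value for player $i$ is a function $\phi_i:\mathfrak{I}\to\mathbb{R}$. Star of $i$: $\operatorname{St}_\Delta i=\{A : A\subseteq T \text{ for some } T\in\Delta \text{ with } i\in T\}$. Link of $i$: $\operatorname{Lk}_\Delta i=\{T\in\Delta : i\notin T,\ T\cup i\in\Delta\}$. Carrier games: for $\emptyset\neq T\in\Delta$ and $S\in\Delta$, $v_T(S)=1$ if $T\subseteq S$ and $0$ otherwise; for $T\in\Delta$ (including $T=\emptyset$), $\hat v_T(S)=1$ if $T\subsetneq S$ and $0$ otherwise. A game $v$ is monotone if $v(S)\le v(T)$ whenever $S\subseteq T\in\Delta$. Monotonicity axiom: $\phi_i(v)\ge 0$ for every monotone $v\in\mathfrak I$. *)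

(* Defs.v *)
From mathcomp Require Import all_boot all_order all_algebra.
From mathcomp Require Import boolp classical_sets reals.

Set Implicit Arguments.
Unset Strict Implicit.
Unset Printing Implicit Defensive.

Import Order.TTheory GRing.Theory Num.Theory.
Local Open Scope ring_scope.

Section SimplicialComplexes.
Variable n : nat.
Implicit Types (Delta : {set {set 'I_n}}) (i : 'I_n).

(* Singletons are not required to be faces. *)
Definition simplicial_complex Delta : Prop :=
  forall S T : {set 'I_n}, T \in Delta -> S \subset T -> S \in Delta.

Definition star Delta i : {set {set 'I_n}} :=
  [set A : {set 'I_n} | [exists T in Delta, (i \in T) && (A \subset T)]].

Definition link Delta i : {set {set 'I_n}} :=
  [set T in Delta | (i \notin T) && (i |: T \in Delta)].

Definition face Delta := {S : {set 'I_n} | S \in Delta}.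

Definition link_face Delta i := {T : {set 'I_n} | T \in link Delta i}.

Lemma link_face_in Delta i (T : link_face Delta i) : val T \in Delta.
Proof. by case: T => T /=; rewrite inE => /andP[]. Qed.

Lemma link_face_addin Delta i (T : link_face Delta i) : i |: val T \in Delta.
Proof. by case: T => T /=; rewrite inE => /and3P[]. Qed.

(* For T in the link of i, both T and T U i are faces, so that a function
   defined on Delta only can be applied to them. *)
Definition without Delta i (T : link_face Delta i) : face Delta :=
  exist _ (val T) (link_face_in T).

Definition adjoin Delta i (T : link_face Delta i) : face Delta :=
  exist _ (i |: val T) (link_face_addin T).

End SimplicialComplexes.

Section Games.
Variables (R : realType) (n : nat) (Delta : {set {set 'I_n}}).

(* R^o is R as a module over itself, which gives the
   pointwise scaling a *: v. *)
Definition face_fun := {ffun face Delta -> R^o}.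

Definition games : set face_fun :=
  [set v : face_fun | forall S : face Delta, val S = finset.set0 -> v S = 0]%classic.

Definition cone_of_games (I : set face_fun) : Prop :=
  (I `<=` games)%classic /\
  forall (a : R) (v : face_fun), 0 < a -> I v -> I (a *: v).

(* A game only when T is non-empty: the carrier game of the empty set takes the
   value 1 at the empty face. *)
Definition carrier_game (T : {set 'I_n}) : face_fun :=
  [ffun S : face Delta => (T \subset val S)%:R].

Definition hat_carrier_game (T : {set 'I_n}) : face_fun :=
  [ffun S : face Delta => (T \proper val S)%:R].

Definition monotone_game (v : face_fun) : Prop :=
  forall S T : face Delta, val S \subset val T -> (v S : R) <= v T.

(* An individual value is a function on the subtype of elements of I. *)
Definition monotonicity_axiom (I : set face_fun) (phi : I -> R) : Prop :=
  forall v : I, monotone_game (val v) -> 0 <= phi v.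

End Games.

Definition probability_distribution (R : realType) (A : finType) (p : A -> R)
  : Prop := (forall x : A, 0 <= p x) /\ \sum_(x : A) p x = 1.

(* Main.v *)
Require Import Defs.
From mathcomp Require Import all_boot all_order all_algebra.
From mathcomp Require Import boolp classical_sets reals.

Import Order.TTheory GRing.Theory Num.Theory.
Local Open Scope ring_scope.

(** The game [hat v_T] is monotone, and for [T] in the link of [i] the player [i]
    has a nonzero marginal contribution to it only at [T], where it is [1]; hence
    [phi (hat v_T) = p T], and monotonicity gives [p T >= 0]. *)

Lemma hat_carrier_game_monotone (R : realType) (n : nat)
    (Delta : {set {set 'I_n}}) (T : {set 'I_n}) :
  monotone_game (hat_carrier_game R Delta T).
Proof.
move=> S S' sSS'; rewrite !ffunE ler_nat.
by case: (boolP (T \proper val S)) => // /proper_sub_trans/(_ sSS') ->.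
Qed.

(** Since [i] is not in [T], the inclusion of [T] in [S] with [i] added is proper as soon as [T]
    lies in [S]. The difference thus compares inclusion with proper inclusion of [T] in [S], which
    disagree only when the two are equal. *)
Lemma hat_carrier_game_marginal (R : realType) (n : nat)
    (Delta : {set {set 'I_n}}) (i : 'I_n) (T S : link_face Delta i) :
  hat_carrier_game R Delta (val T) (adjoin S)
    - hat_carrier_game R Delta (val T) (without S) = (S == T)%:R :> R.
Proof.
have := valP T; rewrite inE => /and3P[_ iNT _].
have sTU : (val T \proper i |: val S) = (val T \subset val S).
  rewrite properE finset.subUset finset.sub1set (negPf iNT) /= andbT.
  apply/fintype.subsetP/fintype.subsetP=> sT x xT; last by rewrite inE sT ?orbT.
  by have := sT x xT; case/finset.setU1P=> // xi; rewrite xi (negPf iNT) in xT.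
(* Equality of link faces is turned into equality of the underlying sets, the condition that
   separates proper from plain inclusion. *)
rewrite !ffunE /= sTU finset.properEneq [S == T]eq_sym -[T == S](inj_eq val_inj).
have [->|_] := eqVneq (val T) (val S); first by rewrite subxx subr0.
by rewrite subrr.
Qed.

(** This makes [hhat] available at every [T] of the link, the empty face included; the face
    containing both [T] and [i] is [i |: T]. *)
Lemma link_sub_star (n : nat) (Delta : {set {set 'I_n}}) (i : 'I_n) :
  link Delta i \subset star Delta i.
Proof.
apply/fintype.subsetP=> T; rewrite !inE => /and3P[_ _ UDelta].
by apply/existsP; exists (i |: T); rewrite UDelta finset.setU11 finset.subsetUr.
Qed.

Theorem theorem3 (R : realType) (n : nat) (Delta : {set {set 'I_n}})
    (hDelta : simplicial_complex Delta) (hne : Delta != finset.set0)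
    (i : 'I_n)
    (I : set (face_fun R Delta)) (hI : cone_of_games I)
    (hcarrier : forall T : {set 'I_n},
        T \in star Delta i -> T != finset.set0 -> I (carrier_game R Delta T))
    (hhat : forall T : {set 'I_n},
        T \in star Delta i -> I (hat_carrier_game R Delta T))
    (phi : I -> R) (p : link_face Delta i -> R)
    (hphi : forall v : I,
        phi v = \sum_(T : link_face Delta i)
                  p T * (val v (adjoin T) - val v (without T)))
    (hp : \sum_(T : link_face Delta i) p T = 1)
    (hmon : monotonicity_axiom phi) :
  probability_distribution p.
Proof.
(* The total mass is [hp]; only nonnegativity at a fixed [T] remains. *)
split=> // T.
have IT := hhat _ (fintype.subsetP (link_sub_star _ Delta i) _ (valP T)).
have := hmon (SigSub (mem_set IT)) (hat_carrier_game_monotone _ _ _ _).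
rewrite hphi (bigD1 T) //= hat_carrier_game_marginal eqxx mulr1 big1 ?addr0 //.
by move=> S /negPf neqST; rewrite hat_carrier_game_marginal neqST mulr0.
Qed.
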